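(* Let $(R,\mathfrak m)$ be a $d$-dimensional Noetherian local ring, let $T$ be an $R$-algebra equipped with a value map such that $T$ is almost Cohen-Macaulay over $R$, and let $M$ be an almost faithfully flat $T$-module. Then $$H^{d-i}_{\mathfrak m}(M)\approx H^{d-i}_{\mathfrak m}(T)\otimes_T M$$ for all $i$. In particular, $M$ is almost Cohen-Macaulay over $R$.
   Context: A value map on a commutative ring $T$ is a map $v:T\to\mathbb R\cup\{\infty\}$ with $v(ab)=v(a)+v(b)$ and $v(a+b)\ge\min\{v(a),v(b)\}$ for all $a,b\in T$, and $v(0)=\infty$. A $T$-module $M$ is almost zero ($M\approx 0$) if for every $m\in M$ and $\epsilon>0$ there is $b\in T$ with $bm=0$ and $v(b)<\epsilon$. Two $T$-modules $M,N$ satisfy $M\approx N$ (are in the same class) if there are a $T$-module $L$ and almost isomorphisms $L\to M$ and $L\to N$, where a $T$-homomorphism is an almost isomorphism if its kernel and cokernel are almost zero. A $T$-module $M$ is almost Cohen-Macaulay over $R$ if $H^i_{\mathfrak m}(M)$ is almost zero for all $i\ne d=\dim R$ but $M/\mathfrak m M$ is not almost zero. $M$ is almost flat if $\operatorname{Tor}^T_i(M,N)\approx0$ for all $i>0$ and all $T$-modules $N$; it is almost faithfully flat if it is almost flat and, for each $T$-module $N$, $M\otimes_TN\approx 0$ implies $N\approx 0$. $H^i_{\mathfrak m}(-)$ is the $i$-th cohomology of the Čech complex on a system of parameters of $R$. *)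

(* Defs.v *)
From HB Require Import structures.
From mathcomp Require Import all_boot all_order all_algebra.
From mathcomp Require Import generic_quotient ring_quotient.
From mathcomp Require Import boolp reals constructive_ereal.
From mathcomp.multinomials Require Import freeg.
From mathcomp Require Import zify ring.

Set Implicit Arguments.
Unset Strict Implicit.
Unset Printing Implicit Defensive.

Import Order.TTheory GRing.Theory.
Local Open Scope ring_scope.
Local Open Scope quotient_scope.

(* Modules are [lmodType]s over a commutative ring.  Submodules and ideals are
   boolean predicates; classically ([asbool]) this is no restriction. *)

Section Span.
Variables (A : pzRingType) (V : lmodType A).

Definition span (P : V -> Prop) : {pred V} := fun v =>
  `[< exists s : seq (A * V),
        (forall p, p \in s -> P p.2) /\ v = \sum_(p <- s) p.1 *: p.2 >].

Lemma span_submod_closed P : submod_closed (span P).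
Proof.
split; first by apply/asboolP; exists [::]; rewrite big_nil; split.
move=> a u v /asboolP[s [sP ->]] /asboolP[t [tP ->]]; apply/asboolP.
exists ([seq (a * p.1, p.2) | p <- s] ++ t); split.
  by move=> p; rewrite mem_cat => /orP[/mapP[q /sP qP ->]|/tP].
rewrite big_cat big_map /= scaler_sumr; congr (_ + _).
by apply: eq_bigr => p _; rewrite scalerA.
Qed.

HB.instance Definition _ (P : V -> Prop) :=
  GRing.isSubmodClosed.Build A V (span P) (span_submod_closed P).
End Span.

Section QuotientModule.
Variables (A : pzRingType) (V : lmodType A) (S : submodClosed V).

(* [submodClosed] does not inherit from [zmodClosed]; this restores it. *)
Definition submod_pred : {pred V} := S.

Lemma submod_pred_zmod_closed : zmod_closed submod_pred.
Proof.
split=> [|x y xS yS]; first exact: (rpred0 S).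
by rewrite -scaleN1r; apply: (rpredD xS); apply: rpredZ.
Qed.

HB.instance Definition _ :=
  GRing.isZmodClosed.Build V submod_pred submod_pred_zmod_closed.

Definition quotmod : Type := Quotient.quot submod_pred.

HB.instance Definition _ := GRing.Zmodule.on quotmod.

Definition quotmod_pi (x : V) : quotmod := \pi_(Quotient.quot submod_pred) x.

Lemma quotmod_piP x y : quotmod_pi x = quotmod_pi y <-> x - y \in S.
Proof.
have := Quotient.idealrBE (submod_pred : zmodClosed V) x y.
by rewrite /quotmod_pi => ->; split=> [->|/eqP].
Qed.

Lemma quotmod_reprK (x : quotmod) :
  quotmod_pi (repr (x : Quotient.quot submod_pred)) = x.
Proof. exact: reprK. Qed.

Lemma quotmod_piD x y : quotmod_pi (x + y) = quotmod_pi x + quotmod_pi y.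
Proof. exact: (raddfD (\pi_(Quotient.quot submod_pred))). Qed.

Definition quotmod_scale (a : A) (x : quotmod) : quotmod :=
  quotmod_pi (a *: repr (x : Quotient.quot submod_pred)).

Lemma quotmod_piZ a x : quotmod_pi (a *: x) = quotmod_scale a (quotmod_pi x).
Proof.
by apply/quotmod_piP; rewrite -scalerBr rpredZ //; apply/quotmod_piP;
  rewrite quotmod_reprK.
Qed.

Lemma quotmod_scaleA a b x :
  quotmod_scale a (quotmod_scale b x) = quotmod_scale (a * b) x.
Proof. by rewrite -[x]quotmod_reprK -!quotmod_piZ scalerA. Qed.

Lemma quotmod_scale1 : left_id 1 quotmod_scale.
Proof. by move=> x; rewrite -[x]quotmod_reprK -!quotmod_piZ scale1r. Qed.

Lemma quotmod_scaleDr : right_distributive quotmod_scale +%R.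
Proof.
move=> a x y; rewrite -[x]quotmod_reprK -[y]quotmod_reprK.
by rewrite -quotmod_piD -!quotmod_piZ -quotmod_piD scalerDr.
Qed.

Lemma quotmod_scaleDl x : {morph quotmod_scale^~ x : a b / a + b}.
Proof.
move=> a b; rewrite -[x]quotmod_reprK.
by rewrite -!quotmod_piZ -quotmod_piD scalerDl.
Qed.

HB.instance Definition _ := GRing.Zmodule_isLmodule.Build A quotmod
  quotmod_scaleA quotmod_scale1 quotmod_scaleDr quotmod_scaleDl.

Lemma quotmod_pi_linear : linear quotmod_pi.
Proof. by move=> a x y; rewrite quotmod_piD quotmod_piZ. Qed.

HB.instance Definition _ :=
  GRing.isLinear.Build A V quotmod *:%R quotmod_pi quotmod_pi_linear.

Section Lift.
Variables (W : lmodType A) (f : {linear V -> W}).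
Hypothesis fS : forall x, x \in S -> f x = 0.

Definition quotmod_lift_fun of (forall x, x \in S -> f x = 0) :=
  fun x : quotmod => f (repr (x : Quotient.quot submod_pred)).

Lemma quotmod_lift_pi x : quotmod_lift_fun fS (quotmod_pi x) = f x.
Proof.
apply/eqP; rewrite /quotmod_lift_fun -subr_eq0 -linearB fS //.
by apply/quotmod_piP; rewrite quotmod_reprK.
Qed.

Lemma quotmod_lift_linear : linear (quotmod_lift_fun fS).
Proof.
move=> a x y; rewrite -[x]quotmod_reprK -[y]quotmod_reprK -linearP.
by rewrite !quotmod_lift_pi linearP.
Qed.

HB.instance Definition _ := GRing.isLinear.Build A quotmod W *:%R
  (quotmod_lift_fun fS) quotmod_lift_linear.

Definition quotmod_lift : {linear quotmod -> W} := quotmod_lift_fun fS.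
End Lift.
End QuotientModule.

Section KernelImage.
Variables (A : pzRingType) (U V : lmodType A) (f : {linear U -> V}).

Definition ker_pred : {pred U} := fun x => f x == 0.

Lemma ker_submod_closed : submod_closed ker_pred.
Proof.
split=> [|a x y]; rewrite !unfold_in ?linear0 // => /eqP fx /eqP fy.
by rewrite linearP fx fy scaler0 addr0.
Qed.

HB.instance Definition _ :=
  GRing.isSubmodClosed.Build A U ker_pred ker_submod_closed.

Record kermod : Type := Kermod { ker_val : U; _ : ker_val \in ker_pred }.

HB.instance Definition _ := [isSub for ker_val].
HB.instance Definition _ := [Choice of kermod by <:].
HB.instance Definition _ := [SubChoice_isSubLmodule of kermod by <:].

Lemma ker_val_linear : linear ker_val.
Proof. exact: (linearP (val : kermod -> U)). Qed.

HB.instance Definition _ :=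
  GRing.isLinear.Build A kermod U *:%R ker_val ker_val_linear.

Definition im_pred : {pred V} := fun y => `[< exists x, y = f x >].

Lemma im_submod_closed : submod_closed im_pred.
Proof.
split; first by apply/asboolP; exists 0; rewrite linear0.
move=> a u v /asboolP[x ->] /asboolP[y ->]; apply/asboolP.
by exists (a *: x + y); rewrite linearP.
Qed.

HB.instance Definition _ :=
  GRing.isSubmodClosed.Build A V im_pred im_submod_closed.

Definition cokermod : lmodType A := quotmod im_pred.
End KernelImage.

Section Homology.
Variables (A : pzRingType) (U V W : lmodType A).
Variables (f : {linear U -> V}) (g : {linear V -> W}).

Definition bound_pred : {pred kermod g} := fun y => ker_val y \in im_pred f.

Lemma bound_submod_closed : submod_closed bound_pred.
Proof.
have E y : (y \in bound_pred) = (ker_val y \in im_pred f) by [].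
split; first by rewrite E linear0 rpred0.
by move=> a x y; rewrite !E linearP => fx fy; rewrite rpredD ?rpredZ.
Qed.

HB.instance Definition _ :=
  GRing.isSubmodClosed.Build A (kermod g) bound_pred bound_submod_closed.

(* ker g / im f *)
Definition homology : lmodType A := quotmod bound_pred.
End Homology.

Section Product.
Variables (A : pzRingType) (I : finType) (V : I -> lmodType A).

Definition prodmod : Type := {dffun forall i, V i}.

HB.instance Definition _ := Choice.on prodmod.

Implicit Types f g h : prodmod.

Let mk (F : forall i, V i) : prodmod := finfun F.
Definition prodmod0 : prodmod := mk (fun=> 0).
Definition prodmodN f : prodmod := mk (fun i => - f i).
Definition prodmodD f g : prodmod := mk (fun i => f i + g i).
Definition prodmodZ (a : A) f : prodmod := mk (fun i => a *: f i).

Lemma prodmodDA : associative prodmodD.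
Proof. by move=> f g h; apply/ffunP => i; rewrite !ffunE addrA. Qed.
Lemma prodmodDC : commutative prodmodD.
Proof. by move=> f g; apply/ffunP => i; rewrite !ffunE addrC. Qed.
Lemma prodmod0D : left_id prodmod0 prodmodD.
Proof. by move=> f; apply/ffunP => i; rewrite !ffunE add0r. Qed.
Lemma prodmodND : left_inverse prodmod0 prodmodN prodmodD.
Proof. by move=> f; apply/ffunP => i; rewrite !ffunE addNr. Qed.

HB.instance Definition _ :=
  GRing.isZmodule.Build prodmod prodmodDA prodmodDC prodmod0D prodmodND.

Lemma prodmodZA a b f : prodmodZ a (prodmodZ b f) = prodmodZ (a * b) f.
Proof. by apply/ffunP => i; rewrite !ffunE scalerA. Qed.
Lemma prodmod1Z : left_id 1 prodmodZ.
Proof. by move=> f; apply/ffunP => i; rewrite !ffunE scale1r. Qed.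
Lemma prodmodZDr : right_distributive prodmodZ +%R.
Proof. by move=> a f g; apply/ffunP => i; rewrite !ffunE scalerDr. Qed.
Lemma prodmodZDl f : {morph prodmodZ^~ f : a b / a + b}.
Proof. by move=> a b; apply/ffunP => i; rewrite !ffunE scalerDl. Qed.

HB.instance Definition _ := GRing.Zmodule_isLmodule.Build A prodmod
  prodmodZA prodmod1Z prodmodZDr prodmodZDl.

Lemma prodmodPE (a : A) f g i : (a *: f + g) i = a *: f i + g i.
Proof. by rewrite !ffunE. Qed.
End Product.

Section Localization.
Variables (A : comPzRingType) (V : lmodType A) (a : A).

(* The localization V_a: the pair (m, n) stands for the fraction m / a^n. *)
Definition loc_equiv (p q : V * nat) : bool :=
  `[< exists k, a ^+ k *: (a ^+ q.2 *: p.1 - a ^+ p.2 *: q.1) = 0 >].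

Lemma loc_equivP (p q : V * nat) :
  reflect (exists k, a ^+ (k + q.2) *: p.1 = a ^+ (k + p.2) *: q.1)
          (loc_equiv p q).
Proof.
apply: (iffP (asboolP _)) => -[k e]; exists k.
  by apply/eqP; rewrite -subr_eq0 !exprD -!scalerA -scalerBr e.
by rewrite scalerBr !scalerA -!exprD e subrr.
Qed.

Lemma loc_equiv_is_equiv : equiv_class_of loc_equiv.
Proof.
split=> [p|p q|q p r].
- by apply/loc_equivP; exists 0%N.
- by apply/loc_equivP/loc_equivP => -[k e]; exists k.
move=> /loc_equivP[k e] /loc_equivP[l e']; apply/loc_equivP.
exists (k + l + q.2)%N.
have -> : (k + l + q.2 + r.2 = l + r.2 + (k + q.2))%N by lia.
rewrite exprD -scalerA e scalerA -exprD.
have -> : (l + r.2 + (k + p.2) = k + p.2 + (l + r.2))%N by lia.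
rewrite exprD -scalerA e' scalerA -exprD.
by congr (a ^+ _ *: _); lia.
Qed.

Canonical loc_equiv_equiv := EquivRelPack loc_equiv_is_equiv.
Canonical loc_equiv_encModRel := defaultEncModRel loc_equiv.

Definition loc : Type := {eq_quot loc_equiv}.

HB.instance Definition _ : EqQuotient (V * nat)%type loc_equiv loc :=
  EqQuotient.on loc.
HB.instance Definition _ := Choice.on loc.

Definition frac (m : V) (n : nat) : loc := \pi_loc (m, n).

Lemma fracP m n m' n' : frac m n = frac m' n' <->
  exists k, a ^+ (k + n') *: m = a ^+ (k + n) *: m'.
Proof.
split=> [/eqP|e]; last by apply/eqP; rewrite piE; apply/loc_equivP.
by rewrite piE => /loc_equivP.
Qed.

Definition locD (x y : loc) : loc :=
  frac (a ^+ (repr y).2 *: (repr x).1 + a ^+ (repr x).2 *: (repr y).1)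
       ((repr x).2 + (repr y).2)%N.
Definition locN (x : loc) : loc := frac (- (repr x).1) (repr x).2.
Definition locZ (b : A) (x : loc) : loc := frac (b *: (repr x).1) (repr x).2.

Lemma frac_repr (x : loc) : frac (repr x).1 (repr x).2 = x.
Proof. by rewrite /frac -surjective_pairing reprK. Qed.

Lemma frac_reprP m n : exists k,
  a ^+ (k + n) *: (repr (frac m n)).1 = a ^+ (k + (repr (frac m n)).2) *: m.
Proof. by apply/fracP; rewrite frac_repr. Qed.

Lemma locDE m n m' n' : locD (frac m n) (frac m' n') =
  frac (a ^+ n' *: m + a ^+ n *: m') (n + n').
Proof.
rewrite /locD; case: (frac_reprP m n) (frac_reprP m' n').
case: (repr (frac m n)) (repr (frac m' n')) => [u i] [v j] /= k e [l e'].
apply/fracP; exists (k + l)%N; rewrite !scalerDr !scalerA -!exprD.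
congr (_ + _).
  have -> : (k + l + (n + n') + j = l + n' + j + (k + n))%N by lia.
  rewrite exprD -scalerA e scalerA -exprD.
  by congr (a ^+ _ *: _); lia.
have -> : (k + l + (n + n') + i = k + n + i + (l + n'))%N by lia.
rewrite exprD -scalerA e' scalerA -exprD.
by congr (a ^+ _ *: _); lia.
Qed.

Lemma locNE m n : locN (frac m n) = frac (- m) n.
Proof.
rewrite /locN; case: (frac_reprP m n) => k e.
by apply/fracP; exists k; rewrite !scalerN e.
Qed.

Lemma locZE b m n : locZ b (frac m n) = frac (b *: m) n.
Proof.
rewrite /locZ; case: (frac_reprP m n) => k e; apply/fracP; exists k.
by rewrite !scalerA ![_ * b]mulrC -!scalerA e.
Qed.

Lemma locDA : associative locD.
Proof.
move=> x y z; rewrite -[x]frac_repr -[y]frac_repr -[z]frac_repr !locDE.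
rewrite !scalerDr !scalerA -!exprD !addrA addnA.
by rewrite [((repr z).2 + (repr y).2)%N]addnC [((repr z).2 + (repr x).2)%N]addnC.
Qed.
Lemma locDC : commutative locD.
Proof.
move=> x y; rewrite -[x]frac_repr -[y]frac_repr !locDE.
by rewrite addrC addnC.
Qed.
Lemma loc0D : left_id (frac 0 0) locD.
Proof.
move=> x; rewrite -[x]frac_repr !locDE.
by rewrite scaler0 add0r scale1r.
Qed.
Lemma locND : left_inverse (frac 0 0) locN locD.
Proof.
move=> x; rewrite -[x]frac_repr locNE !locDE scalerN addNr.
by apply/fracP; exists 0%N; rewrite !scaler0.
Qed.

HB.instance Definition _ := GRing.isZmodule.Build loc locDA locDC loc0D locND.

Lemma locZA b c x : locZ b (locZ c x) = locZ (b * c) x.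
Proof. by rewrite -[x]frac_repr !locZE scalerA. Qed.
Lemma loc1Z : left_id 1 locZ.
Proof. by move=> x; rewrite -[x]frac_repr !locZE scale1r. Qed.
Lemma locZDr : right_distributive locZ +%R.
Proof.
move=> b x y; rewrite -[x]frac_repr -[y]frac_repr.
rewrite -[LHS]/(locZ b (locD _ _)) -[RHS]/(locD (locZ b _) (locZ b _)).
by rewrite locDE !locZE locDE scalerDr !scalerA ![b * _]mulrC.
Qed.
Lemma locZDl x : {morph locZ^~ x : b c / b + c}.
Proof.
move=> b c; rewrite -[x]frac_repr -[RHS]/(locD (locZ b _) (locZ c _)).
rewrite !locZE locDE -scalerDr -scalerDl; apply/fracP; exists 0%N.
by rewrite !add0n [RHS]scalerA -exprD.
Qed.

HB.instance Definition _ :=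
  GRing.Zmodule_isLmodule.Build A loc locZA loc1Z locZDr locZDl.

Lemma fracD m n m' n' :
  frac m n + frac m' n' = frac (a ^+ n' *: m + a ^+ n *: m') (n + n').
Proof. exact: locDE. Qed.
Lemma fracZ b m n : b *: frac m n = frac (b *: m) n.
Proof. exact: locZE. Qed.
End Localization.

Section LocalizationMap.
Variables (A : comPzRingType) (V : lmodType A) (a b c : A).
Hypothesis cab : c = a * b.

(* The canonical map V_a -> V_{ab}, m / a^n |-> (b^n m) / (ab)^n. *)
Definition locmap_fun of (c = a * b) := fun x : loc V a =>
  frac c (b ^+ (repr x).2 *: (repr x).1) (repr x).2.

Lemma locmap_frac m n :
  locmap_fun cab (frac a m n) = frac c (b ^+ n *: m) n.
Proof.
rewrite /locmap_fun; case: (frac_reprP a m n) => k e; apply/fracP; exists k.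
move: e; case: (repr _) => [u i] /= e.
rewrite !scalerA cab !exprMn.
have -> : a ^+ (k + n) * b ^+ (k + n) * b ^+ i
        = b ^+ (k + n + i) * a ^+ (k + n) by rewrite -mulrA -exprD mulrC.
rewrite -scalerA e scalerA mulrC -mulrA -exprD.
by congr ((_ * b ^+ _) *: _); lia.
Qed.

Lemma locmap_linear : linear (locmap_fun cab).
Proof.
move=> r x y; rewrite -[x]frac_repr -[y]frac_repr.
case: (repr x) (repr y) => [m n] [m' n'] /=.
rewrite fracZ fracD !locmap_frac fracZ fracD cab.
congr (frac _ _ _); rewrite !exprMn !exprD scalerDr !scalerA.
by congr (_ *: _ + _ *: _); ring.
Qed.

HB.instance Definition _ := GRing.isLinear.Build A (loc V a) (loc V c) *:%R
  (locmap_fun cab) locmap_linear.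

Definition locmap : {linear loc V a -> loc V c} := locmap_fun cab.
End LocalizationMap.

Section Cech.
Variables (A : comPzRingType) (d : nat) (x : 'I_d -> A) (V : lmodType A).

Definition subprod (I : {set 'I_d}) : A := \prod_(i in I) x i.

Lemma subprodD1 (J : {set 'I_d}) (j : {j : 'I_d | j \in J}) :
  subprod J = subprod (J :\ val j) * x (val j).
Proof. by rewrite mulrC /subprod (big_setD1 (val j)) ?(valP j). Qed.

(* Cohomological degrees are integers, so that the complex vanishes outside
   the range 0, ..., d. *)
Definition cech_index (n : int) : finType := {I : {set 'I_d} | #|I|%:Z == n}.

Lemma cech_face_subproof (p q : int) (epq : q = p + 1) (J : cech_index q)
  (j : {j : 'I_d | j \in val J}) : #|val J :\ val j|%:Z == p.
Proof.
apply/eqP/(addIr 1); apply: etrans epq; apply: etrans (eqP (valP J)).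
by rewrite [in RHS](cardsD1 (val j)) (valP j) PoszD addrC.
Qed.

Definition cech_face (p q : int) (epq : q = p + 1) (J : cech_index q)
    (j : {j : 'I_d | j \in val J}) : cech_index p :=
  exist _ (val J :\ val j) (cech_face_subproof epq j).

Definition cech (n : int) : lmodType A :=
  prodmod (fun I : cech_index n => loc V (subprod (val I)) : lmodType A).

Definition cech_diff_fun (p q : int) (epq : q = p + 1) (f : cech p) : cech q :=
  finfun (fun J : cech_index q =>
    \sum_(j : {j : 'I_d | j \in val J})
      (-1) ^+ #|[set i in val J | (i < val j)%N]| *:
        locmap V (subprodD1 j) (f (cech_face epq j))).

Lemma cech_diff_linear p q epq : linear (@cech_diff_fun p q epq).
Proof.
move=> a f g; apply/ffunP => J; rewrite prodmodPE !ffunE.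
rewrite scaler_sumr -big_split; apply: eq_bigr => j _ /=.
by rewrite prodmodPE linearP scalerDr !scalerA mulrC.
Qed.

HB.instance Definition _ p q epq := GRing.isLinear.Build A (cech p) (cech q)
  *:%R (@cech_diff_fun p q epq) (@cech_diff_linear p q epq).

Definition cech_diff p q epq : {linear cech p -> cech q} :=
  @cech_diff_fun p q epq.

Definition cech_cohomology (n : int) : lmodType A :=
  homology (@cech_diff (n - 1) n (esym (subrK 1 n)))
           (@cech_diff n (n + 1) erefl).
End Cech.

Section Tensor.
Variables (A : comNzRingType).

Section Def.
Variables M N : lmodType A.

Inductive tensor_rel : {freeg (M * N) / A} -> Prop :=
| TensorDl m m' n :
    tensor_rel (<< (m + m', n) >> - << (m, n) >> - << (m', n) >>)
| TensorDr m n n' :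
    tensor_rel (<< (m, n + n') >> - << (m, n) >> - << (m, n') >>)
| TensorZl a m n : tensor_rel (<< (a *: m, n) >> - a *: << (m, n) >>)
| TensorZr a m n : tensor_rel (<< (m, a *: n) >> - a *: << (m, n) >>).

Definition tensor : lmodType A := quotmod (span tensor_rel).

Definition pure (m : M) (n : N) : tensor :=
  quotmod_pi (span tensor_rel) << (m, n) >>.
End Def.

Lemma pureDl (M N : lmodType A) (m m' : M) (n : N) : pure (m + m') n = pure m n + pure m' n.
Proof.
apply/eqP; rewrite -subr_eq0 opprD addrA -!linearB -(linear0 (quotmod_pi _)).
apply/eqP/quotmod_piP; rewrite subr0; apply/asboolP.
exists [:: (1, << (m + m', n) >> - << (m, n) >> - << (m', n) >>)].
rewrite big_seq1 scale1r; split=> // p; rewrite inE => /eqP -> /=.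
exact: TensorDl.
Qed.

Lemma pureDr (M N : lmodType A) (m : M) (n n' : N) : pure m (n + n') = pure m n + pure m n'.
Proof.
apply/eqP; rewrite -subr_eq0 opprD addrA -!linearB -(linear0 (quotmod_pi _)).
apply/eqP/quotmod_piP; rewrite subr0; apply/asboolP.
exists [:: (1, << (m, n + n') >> - << (m, n) >> - << (m, n') >>)].
rewrite big_seq1 scale1r; split=> // p; rewrite inE => /eqP -> /=.
exact: TensorDr.
Qed.

Lemma pureZl (M N : lmodType A) a (m : M) (n : N) : pure (a *: m) n = a *: pure m n.
Proof.
apply/eqP; rewrite -subr_eq0 -linearZ -linearB -(linear0 (quotmod_pi _)).
apply/eqP/quotmod_piP; rewrite subr0; apply/asboolP.
exists [:: (1, << (a *: m, n) >> - a *: << (m, n) >>)].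
rewrite big_seq1 scale1r; split=> // p; rewrite inE => /eqP -> /=.
exact: TensorZl.
Qed.

Lemma pureZr (M N : lmodType A) a (m : M) (n : N) : pure m (a *: n) = a *: pure m n.
Proof.
apply/eqP; rewrite -subr_eq0 -linearZ -linearB -(linear0 (quotmod_pi _)).
apply/eqP/quotmod_piP; rewrite subr0; apply/asboolP.
exists [:: (1, << (m, a *: n) >> - a *: << (m, n) >>)].
rewrite big_seq1 scale1r; split=> // p; rewrite inE => /eqP -> /=.
exact: TensorZr.
Qed.

Section FreeLift.
Variables (K : choiceType) (W : lmodType A) (h : K -> W).

Lemma fglift_linear : linear (fglift h : {freeg K / A} -> W).
Proof.
move=> a D E; rewrite -[D]freeg_sumE scaler_sumr.
pose L := fglift h.
have LB : {morph L : u v / u - v} by exact: lift_is_additive.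
have L0 : L 0 = 0 by rewrite -[0 in LHS](subrr 0) LB subrr.
have LN u : L (- u) = - L u by rewrite -[- u]add0r LB L0 sub0r.
have LD : {morph L : u v / u + v}.
  by move=> u v; rewrite -{1}[v]opprK LB LN opprK.
rewrite -/L LD; congr (_ + _).
rewrite !(big_morph L LD L0) scaler_sumr; apply: eq_bigr => k _.
have -> : a *: << coeff k D *g k >> = << a * coeff k D *g k >>.
  by apply/eqP/freeg_eqP => j; rewrite coeffZ !coeffU mulrA.
by rewrite /L !liftU scalerA.
Qed.

Definition free_lift_fun (D : {freeg K / A}) : W := fglift h D.

HB.instance Definition _ := GRing.isLinear.Build A {freeg K / A} W *:%R
  free_lift_fun fglift_linear.

Definition free_lift : {linear {freeg K / A} -> W} := free_lift_fun.

Lemma free_liftU k : free_lift << k >> = h k.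
Proof. by rewrite /= /free_lift_fun liftU scale1r. Qed.
End FreeLift.

Section Map.
Variables (M M' N : lmodType A) (f : {linear M -> M'}).

Definition tensor_map0 : {linear {freeg (M * N) / A} -> tensor M' N} :=
  free_lift (fun p : M * N => pure (f p.1) p.2).

Lemma tensor_map_subproof u :
  u \in span (@tensor_rel M N) -> tensor_map0 u = 0.
Proof.
move=> /asboolP[s [sP ->]]; rewrite linear_sum big_seq big1 // => p /sP.
rewrite linearZ /=; case: p => a v /=.
suff e0 w : tensor_rel w -> tensor_map0 w = 0 by move/e0 ->; rewrite scaler0.
case=> [m m' n|m n n'|b m n|b m n].
- by rewrite !linearB !free_liftU /= linearD pureDl addrAC addrK subrr.
- by rewrite !linearB !free_liftU /= pureDr addrAC addrK subrr.
- by rewrite linearB linearZ !free_liftU /= linearZ pureZl subrr.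
- by rewrite linearB linearZ !free_liftU /= pureZr subrr.
Qed.

Definition tensor_map : {linear tensor M N -> tensor M' N} :=
  quotmod_lift tensor_map_subproof.

Lemma tensor_map_pure m n : tensor_map (pure m n) = pure (f m) n.
Proof. by rewrite [LHS]quotmod_lift_pi free_liftU. Qed.
End Map.
End Tensor.

Section Tor.
Variables (A : comNzRingType) (M N : lmodType A).

(* The free module on the underlying set of a module, and its canonical
   surjection onto that module. *)
Definition cover (V : lmodType A) : lmodType A := {freeg V / A}.
Definition cover_map (V : lmodType A) : {linear cover V -> V} :=
  free_lift (id : V -> V).

(* The standard free resolution ... -> F_1 -> F_0 -> M -> 0 of M: F_n is the
   cover of the n-th syzygy, and the syzygies are iterated kernels. *)
Fixpoint syzygy (n : nat) : lmodType A :=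
  if n is n'.+1 then kermod (cover_map (syzygy n')) else M.

Definition resolution (n : nat) : lmodType A := cover (syzygy n).

Definition resolution_diff (n : nat) :
    {linear resolution n.+1 -> resolution n} :=
  (@ker_val _ _ _ (cover_map (syzygy n)) : {linear syzygy n.+1 -> _})
    \o cover_map (syzygy n.+1).

Definition Tor (i : nat) : lmodType A :=
  if i is i'.+1 then
    homology (tensor_map N (resolution_diff i'.+1))
             (tensor_map N (resolution_diff i'))
  else cokermod (tensor_map N (resolution_diff 0)).
End Tor.

Section LocalRings.
Variable R : comNzRingType.
Implicit Types I J P m : {pred R}.

(* [idealr_closed] is the library predicate for proper ideals. *)
Definition ideal I := @submod_closed R R^o I.
Definition prime_ideal P := idealr_closed P /\ prime_idealr_closed P.
Definition maximal_ideal m := idealr_closed m /\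
  forall J, idealr_closed J -> {subset m <= J} -> J =i m.

Definition gen_ideal (S : R -> Prop) : {pred R} := @span R R^o S.

Definition noetherian := forall I, ideal I ->
  exists s : seq R, I =i gen_ideal (fun r => r \in s).

Definition local_ring m :=
  maximal_ideal m /\ forall m', maximal_ideal m' -> m' =i m.

Definition prime_chain n (c : 'I_n.+1 -> {pred R}) :=
  (forall i, prime_ideal (c i)) /\
  forall i j : 'I_n.+1, (i < j)%N ->
    {subset c i <= c j} /\ exists2 r, r \in c j & r \notin c i.

Definition krull_dim (d : nat) :=
  (exists c, @prime_chain d c) /\
  forall n c, @prime_chain n c -> (n <= d)%N.

(* For d = dim R: the sequence x generates an ideal with radical m. *)
Definition system_of_parameters m (d : nat) (x : 'I_d -> R) :=
  (forall i, x i \in m) /\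
  forall r, r \in m <->
    exists n, r ^+ n \in gen_ideal (fun y => exists i, y = x i).
End LocalRings.

Section Almost.
Variables (K : realType) (T : comNzRingType).

Definition value_map (v : T -> \bar K) :=
  [/\ forall a, v a != -oo%E,
      v 0 = +oo%E,
      forall a b, v (a * b) = (v a + v b)%E &
      forall a b, (Order.min (v a) (v b) <= v (a + b)%R)%E].

Variable v : T -> \bar K.

Definition almost_zero (M : lmodType T) :=
  forall (m : M) (e : K), 0 < e ->
    exists b : T, b *: m = 0 /\ (v b < e%:E)%E.

Definition almost_iso (L M : lmodType T) (f : {linear L -> M}) :=
  almost_zero (kermod f) /\ almost_zero (cokermod f).

Definition almost_equiv (M N : lmodType T) :=
  exists (L : lmodType T) (f : {linear L -> M}) (g : {linear L -> N}),
    almost_iso f /\ almost_iso g.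

Definition almost_flat (M : lmodType T) :=
  forall (i : nat) (N : lmodType T), (0 < i)%N -> almost_zero (Tor M N i).

Definition almost_faithfully_flat (M : lmodType T) :=
  almost_flat M /\
  forall N : lmodType T, almost_zero (tensor M N) -> almost_zero N.
End Almost.

Section AlmostCM.
Variables (K : realType) (R : comNzRingType) (T : comAlgType R).
Variables (v : T -> \bar K) (m : {pred R}) (d : nat) (x : 'I_d -> R).

(* H^n_m(M), computed on a fixed system of parameters x of (R, m); R acts on
   T-modules through its image in T. *)
Definition local_cohomology (n : int) (M : lmodType T) : lmodType T :=
  cech_cohomology (fun i => (x i)%:A : T) M n.

Definition residue_module (M : lmodType T) : lmodType T :=
  quotmod (span (fun y : M => exists2 r, r \in m & exists z, y = r%:A *: z)).

(* Here d is the dimension of R and x a system of parameters. *)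
Definition almost_CM (M : lmodType T) :=
  (forall i : int, i != d -> almost_zero v (local_cohomology i M)) /\
  ~ almost_zero v (residue_module M).
End AlmostCM.

(* Main.v *)
Require Import Defs.
From HB Require Import structures.
From mathcomp Require Import all_boot all_order all_algebra.
From mathcomp Require Import boolp reals constructive_ereal.
From mathcomp.multinomials Require Import freeg.

(** The Cech complex of [M] is the Cech complex of [T] tensored with [M], since
    localization is base change (lemma [loc_tensor_inj]) and the complex is a
    finite product of localizations in each degree.  So the first claim is that
    homology commutes with [- (x) M] up to almost zero modules.

    This is where almost flatness enters, through [Tor_1]: if
    [g : B -> C] is linear and [w] in [B (x) M] is killed by [g (x) M], then for
    every [e > 0] some [b] with [v b < e] moves [w] into the image of
    [ker g (x) M] (lemma [almost_flat_exact]).  The proof chases [w] through the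
    standard resolution [F_2 -> F_1 -> F_0 -> M] tensored with
    [B -> C -> coker g]; the obstruction that appears is a class in
    [Tor_1 (M, coker g)], which [b] kills.  The rest of the chase uses right
    exactness of the tensor product and flatness of the free modules [F_i].

    Given this, the canonical map from [H (x) M], where [H] is the homology of
    [U -> V -> W], to the homology of [U (x) M -> V (x) M -> W (x) M] is an
    almost isomorphism (lemma [homology_tensor_almost_iso]): its cokernel is
    controlled by [ker g (x) M -> ker (g (x) M)], and its kernel by applying
    the principle to the composite [U -> W] and to the inclusion of [ker g].

    That [M] is almost Cohen-Macaulay follows.  For [n <> d] the module
    [H^n(M)] is almost [H^n(T) (x) M], and tensoring preserves almost zero
    modules.  If [M / m M] were almost zero, so would be [M (x) T / m T],
    because [p |-> p (x) 1] kills [m M] and its image generates; then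
    faithfulness would make [T / m T] almost zero. *)

Set Implicit Arguments.
Unset Strict Implicit.
Unset Printing Implicit Defensive.

Import Order.TTheory GRing.Theory Num.Theory.
Local Open Scope ring_scope.

(** * Kernels, cokernels and homology classes *)

Section QuotientKernel.
Variables (A : pzRingType) (V : lmodType A).

Lemma quotmod_pi0P (S : submodClosed V) (y : V) :
  quotmod_pi S y = 0 <-> y \in S.
Proof. by rewrite -(linear0 (quotmod_pi S)) quotmod_piP subr0. Qed.

Lemma quotmod_pi_surj (S : submodClosed V) (y : quotmod S) :
  exists z, y = quotmod_pi S z.
Proof. by eexists; rewrite -[LHS]quotmod_reprK; reflexivity. Qed.

Variables (U : lmodType A) (f : {linear U -> V}).

Definition coker_pi : {linear V -> cokermod f} := quotmod_pi (im_pred f).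

Lemma coker_pi_surj (y : cokermod f) : exists z, y = coker_pi z.
Proof. exact: quotmod_pi_surj. Qed.

Lemma coker_pi0P (y : V) : coker_pi y = 0 <-> exists z, y = f z.
Proof.
rewrite quotmod_pi0P.
by split=> [/asboolP|?]; last exact/asboolP.
Qed.

Definition ker_incl : {linear kermod f -> U} := @ker_val A U V f.

Lemma ker_inclP (y : kermod f) : f (ker_incl y) = 0.
Proof. by case: y => y /= /eqP. Qed.

Lemma ker_incl_inj : injective ker_incl.
Proof. exact: val_inj. Qed.

Lemma ker_incl0 (y : kermod f) : ker_incl y = 0 -> y = 0.
Proof. by move=> y0; apply: ker_incl_inj; rewrite linear0. Qed.

Section Corestriction.
Variables (W : lmodType A) (h : {linear W -> U}).
Hypothesis fh0 : forall y, f (h y) = 0.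

Lemma ker_lift_subproof y : h y \in ker_pred f.
Proof. exact/eqP. Qed.

Definition ker_lift_fun of (forall y, f (h y) = 0) :=
  fun y => @Kermod A U V f (h y) (ker_lift_subproof y).

Lemma ker_lift_linear : linear (ker_lift_fun fh0).
Proof. by move=> a y z; apply: ker_incl_inj; rewrite /= linearP. Qed.

HB.instance Definition _ :=
  GRing.isLinear.Build A W (kermod f) *:%R (ker_lift_fun fh0) ker_lift_linear.

Definition ker_lift : {linear W -> kermod f} := ker_lift_fun fh0.
End Corestriction.
End QuotientKernel.

Section HomologyClasses.
Variables (A : pzRingType) (U V W : lmodType A).
Variables (f : {linear U -> V}) (g : {linear V -> W}).

Definition homology_class : {linear kermod g -> homology f g} :=
  quotmod_pi (@bound_pred A U V W f g).

Lemma homology_class_surj y : exists z, y = homology_class z.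
Proof. exact: quotmod_pi_surj. Qed.

Lemma homology_class0P z :
  homology_class z = 0 <-> exists u, ker_incl g z = f u.
Proof.
rewrite quotmod_pi0P.
by split=> [/asboolP|?]; last exact/asboolP.
Qed.
End HomologyClasses.

(** * Exactness properties of the tensor product *)

Section TensorProducts.
Variable A : comNzRingType.

Section Induction.
Variables M N : lmodType A.

Lemma pure0l (n : N) : pure (0 : M) n = 0.
Proof. by rewrite -(scale0r 0) pureZl scale0r. Qed.

Lemma pure0r (m : M) : pure m (0 : N) = 0.
Proof. by rewrite -(scale0r 0) pureZr scale0r. Qed.

Lemma pure_suml (I : Type) (r : seq I) (P : pred I) (F : I -> M) (n : N) :
  pure (\sum_(i <- r | P i) F i) n = \sum_(i <- r | P i) pure (F i) n.
Proof.
exact: (big_morph (fun m => pure m n) (fun a b => pureDl a b n) (pure0l n)).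
Qed.

Lemma tensor_ind (P : tensor M N -> Prop) :
  P 0 -> (forall u w, P u -> P w -> P (u + w)) ->
  (forall m n, P (pure m n)) -> forall z, P z.
Proof.
move=> P0 PD Pp z; have [D ->] := quotmod_pi_surj z.
rewrite -[D]freeg_sumE linear_sum; apply: (big_ind P) => // -[m n] _.
set a := coeff _ _; have -> : << a *g (m, n) >> = a *: << (m, n) >>.
  by apply/eqP/freeg_eqP => j; rewrite coeffZ !coeffU mul1r.
by rewrite linearZ -[X in P X]/(a *: pure m n) -pureZl.
Qed.

Section Lift.
Variables (W : lmodType A) (h : M -> N -> W).
Hypotheses (hl : forall n, linear (h^~ n)) (hr : forall m, linear (h m)).

Let lift0 : {linear {freeg (M * N) / A} -> W} :=
  free_lift (fun p : M * N => h p.1 p.2).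

Lemma tensor_lift_subproof u :
  u \in Defs.span (@tensor_rel A M N) -> lift0 u = 0.
Proof.
move=> /asboolP[s [sP ->]]; rewrite linear_sum big_seq big1 // => p /sP.
rewrite linearZ /=; case: p => a v /=.
suff e0 w : tensor_rel w -> lift0 w = 0 by move/e0 ->; rewrite scaler0.
case=> [m m' n|m n n'|b m n|b m n].
- have /= := hl n 1 m m'; rewrite !scale1r !linearB !free_liftU /= => ->.
  by rewrite addrAC addrK subrr.
- have /= := hr m 1 n n'; rewrite !scale1r !linearB !free_liftU /= => ->.
  by rewrite addrAC addrK subrr.
- by rewrite linearB linearZ !free_liftU /= (scalable_linear (hl n)) subrr.
- by rewrite linearB linearZ !free_liftU /= (scalable_linear (hr m)) subrr.
Qed.

Definition tensor_lift : {linear tensor M N -> W} :=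
  quotmod_lift tensor_lift_subproof.

Lemma tensor_lift_pure m n : tensor_lift (pure m n) = h m n.
Proof. by rewrite [LHS]quotmod_lift_pi free_liftU. Qed.
End Lift.

End Induction.

Section PureLinear.
Variables M N : lmodType A.

Lemma pure_linearl (n : N) : linear (fun m : M => pure m n).
Proof. by move=> a m m'; rewrite pureDl pureZl. Qed.

Lemma pure_linearr (m : M) : linear (fun n : N => pure m n).
Proof. by move=> a n n'; rewrite pureDr pureZr. Qed.
End PureLinear.

Definition tensor_swap (M N : lmodType A) : {linear tensor M N -> tensor N M} :=
  tensor_lift (fun n => @pure_linearr N M n) (fun m => @pure_linearl N M m).

Lemma tensor_swap_pure (M N : lmodType A) (m : M) (n : N) :
  tensor_swap M N (pure m n) = pure n m.
Proof. exact: tensor_lift_pure. Qed.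

Lemma tensor_swapK (M N : lmodType A) :
  cancel (tensor_swap M N) (tensor_swap N M).
Proof.
move=> z; elim/tensor_ind: z => [|u w eu ew|m n];
  [by rewrite !linear0 | by rewrite !linearD eu ew |].
by rewrite !tensor_swap_pure.
Qed.

Section MapRight.
Variables (P N N' : lmodType A) (g : {linear N -> N'}).

Lemma tensor_mapr_subproof (p : P) : linear (fun n : N => pure p (g n)).
Proof. by move=> a n n'; rewrite linearP pureDr pureZr. Qed.

Definition tensor_mapr : {linear tensor P N -> tensor P N'} :=
  tensor_lift (fun n => @pure_linearl P N' (g n))
    tensor_mapr_subproof.

Lemma tensor_mapr_pure (p : P) (n : N) : tensor_mapr (pure p n) = pure p (g n).
Proof. exact: tensor_lift_pure. Qed.

Lemma tensor_mapr_swap z : tensor_mapr z =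
  tensor_swap N' P (tensor_map P g (tensor_swap P N z)).
Proof.
elim/tensor_ind: z => [|u w eu ew|p n];
  [by rewrite !linear0 | by rewrite !linearD eu ew |].
by rewrite tensor_mapr_pure tensor_swap_pure tensor_map_pure tensor_swap_pure.
Qed.

Lemma tensor_map_swap z : tensor_map P g z =
  tensor_swap P N' (tensor_mapr (tensor_swap N P z)).
Proof. by rewrite tensor_mapr_swap !tensor_swapK. Qed.
End MapRight.

Lemma tensor_map_mapr (P P' N N' : lmodType A) (f : {linear P -> P'})
    (g : {linear N -> N'}) z :
  tensor_map N' f (tensor_mapr P g z) = tensor_mapr P' g (tensor_map N f z).
Proof.
elim/tensor_ind: z => [|u w eu ew|p n];
  [by rewrite !linear0 | by rewrite !linearD eu ew |].
by rewrite tensor_map_pure !tensor_mapr_pure tensor_map_pure.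
Qed.

Lemma tensor_map_comp (U V W N : lmodType A) (f : {linear U -> V})
    (g : {linear V -> W}) z :
  tensor_map N g (tensor_map N f z) =
  tensor_map N ((g : {linear _ -> _}) \o f) z.
Proof.
elim/tensor_ind: z => [|u w eu ew|p n];
  [by rewrite !linear0 | by rewrite !linearD eu ew |].
by rewrite !tensor_map_pure.
Qed.

Lemma eq_tensor_map (U V N : lmodType A) (f g : {linear U -> V}) :
  f =1 g -> tensor_map N f =1 tensor_map N g.
Proof.
move=> fg z; elim/tensor_ind: z => [|u w eu ew|p n];
  [by rewrite !linear0 | by rewrite !linearD eu ew |].
by rewrite !tensor_map_pure fg.
Qed.

Lemma tensor_map0 (U V N : lmodType A) (f : {linear U -> V}) z :
  (forall u, f u = 0) -> tensor_map N f z = 0.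
Proof.
move=> f0; elim/tensor_ind: z => [|u w fu fw|m n]; first by rewrite linear0.
  by rewrite linearD fu fw addr0.
by rewrite tensor_map_pure f0 pure0l.
Qed.

Section RightExact.
Variables (V W N : lmodType A) (p : {linear V -> W}).
Hypothesis p_surj : forall w, exists v, w = p v.

Lemma tensor_map_surj z : exists y, z = tensor_map N p y.
Proof.
elim/tensor_ind: z => [|u w [y ->] [y' ->]|w n].
- by exists 0; rewrite linear0.
- by exists (y + y'); rewrite linearD.
by have [v ->] := p_surj w; exists (pure v n); rewrite tensor_map_pure.
Qed.

(** If the sequence is exact at [V] and [p] is onto, then
    [(w, n) |-> class of s w (x) n], for any section [s] of [p], is a bilinear map
    into the cokernel of [f (x) N]: changing [s] changes [s w] by an element of
    the image of [f].  The induced map out of [W (x) N], composed with [p (x) N],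
    is the projection onto this cokernel, so it sends the kernel of [p (x) N]
    to zero. *)
Lemma tensor_map_right_exact (U : lmodType A) (f : {linear U -> V}) z :
  (forall v, p v = 0 -> exists u, v = f u) -> tensor_map N p z = 0 ->
  exists y, z = tensor_map N f y.
Proof.
move=> fp pz0; have [s sK] := choice p_surj.
pose q := coker_pi (tensor_map N f).
(* The class of [v (x) n] depends only on [p v], so the choice of section
   is immaterial and bilinearity follows. *)
have qE v v' n : p v = p v' -> q (pure v n) = q (pure v' n).
  move=> pvv; have [|u uE] := fp (v - v'); first by rewrite linearB pvv subrr.
  apply/eqP; rewrite -subr_eq0 -linearB; apply/eqP/coker_pi0P.
  exists (pure u n); rewrite tensor_map_pure -uE.
  by rewrite (zmod_morphism_linear (@pure_linearl V N n)).
have hl n : linear (fun w => q (pure (s w) n)).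
  move=> a w w'; rewrite -linearZ -linearD -pureZl -pureDl.
  by apply: qE; rewrite linearD linearZ -!sK.
have hr w : linear (fun n => q (pure (s w) n)).
  by move=> a n n'; rewrite pureDr pureZr linearD linearZ.
apply/coker_pi0P; rewrite -/q.
have -> : q z = tensor_lift hl hr (tensor_map N p z).
  elim/tensor_ind: {pz0} z => [|u w eu ew|v n].
  - by rewrite !linear0.
  - by rewrite !linearD eu ew.
  by rewrite tensor_map_pure tensor_lift_pure; apply: qE; rewrite -sK.
by rewrite pz0 linear0.
Qed.
End RightExact.

Section RightExactRight.
Variables (P V W : lmodType A) (p : {linear V -> W}).
Hypothesis p_surj : forall w, exists v, w = p v.

Lemma tensor_mapr_surj z : exists y, z = tensor_mapr P p y.
Proof.
have [y yE] := tensor_map_surj p_surj (tensor_swap P W z).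
exists (tensor_swap V P y).
by rewrite tensor_mapr_swap tensor_swapK -yE tensor_swapK.
Qed.

Lemma tensor_mapr_right_exact (U : lmodType A) (f : {linear U -> V}) z :
  (forall v, p v = 0 -> exists u, v = f u) -> tensor_mapr P p z = 0 ->
  exists y, z = tensor_mapr P f y.
Proof.
move=> fp; rewrite tensor_mapr_swap => /(congr1 (tensor_swap P W)).
rewrite tensor_swapK linear0.
move=> /(tensor_map_right_exact p_surj fp)[y yE]; exists (tensor_swap U P y).
by rewrite tensor_mapr_swap tensor_swapK -yE tensor_swapK.
Qed.
End RightExactRight.

Section FreeFlat.
Variable K : choiceType.
Let F : lmodType A := {freeg K / A}.

Lemma freeg_sum_supset (x : F) (s : seq K) : uniq s -> {subset dom x <= s} ->
  x = \sum_(k <- s) coeff k x *: << k >>.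
Proof.
move=> us xs; apply/eqP/freeg_eqP => j.
rewrite (raddf_sum (coeff j)) /=.
under eq_bigr => k _ do rewrite coeffZ coeffU mul1r.
have [js|js] := boolP (j \in s).
  rewrite (bigD1_seq j) //= eqxx mulr1 big1 ?addr0 // => k /negPf kj.
  by rewrite kj mulr0.
rewrite coeff_outdom ?(contra (xs j)) // big_seq big1 // => k ks.
by case: eqP js => [<-|_]; rewrite ?ks // mulr0.
Qed.

Section Coordinate.
Variable B : lmodType A.

Lemma coord_linearl (k : K) (n : B) : linear (fun x : F => coeff k x *: n).
Proof. by move=> a x y; rewrite coeffD coeffZ scalerDl scalerA. Qed.

Lemma coord_linearr (k : K) (x : F) : linear (fun n : B => coeff k x *: n).
Proof. by move=> a n n'; rewrite scalerDr !scalerA mulrC. Qed.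

Definition tensor_coord (k : K) : {linear tensor F B -> B} :=
  tensor_lift (coord_linearl k) (coord_linearr k).

Lemma tensor_coord_pure k (x : F) n :
  tensor_coord k (pure x n) = coeff k x *: n.
Proof. exact: tensor_lift_pure. Qed.

(** A tensor over a free module is determined by finitely many coordinates.
    Allowing any large enough finite set of basis elements, rather than the exact
    support, makes the claim stable under sums. *)
Lemma tensor_coord_sum z : exists s : seq K,
  z = \sum_(k <- s) pure (<< k >> : F) (tensor_coord k z).
Proof.
suff [s sP] : exists s : seq K, forall s', uniq s' -> {subset s <= s'} ->
    z = \sum_(k <- s') pure (<< k >> : F) (tensor_coord k z).
  by exists (undup s); apply: sP (undup_uniq s) _ => k; rewrite mem_undup.
elim/tensor_ind: z => [|u w [s sP] [t tP]|x n].
- exists [::] => s' _ _; rewrite big1 // => k _.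
  by rewrite linear0 pure0r.
- exists (s ++ t) => s' us' ss'.
  rewrite [in LHS](sP s') => [|//|k ks]; last by rewrite ss' // mem_cat ks.
  rewrite [in LHS](tP s') => [|//|k kt]; last by rewrite ss' // mem_cat kt orbT.
  by rewrite -big_split; apply: eq_bigr => k _; rewrite linearD pureDr.
exists (dom x) => s' us' xs'.
rewrite [in LHS](freeg_sum_supset us' xs') pure_suml; apply: eq_bigr => k _.
by rewrite tensor_coord_pure pureZl pureZr.
Qed.
End Coordinate.

Lemma tensor_coord_mapr (B C : lmodType A) (g : {linear B -> C}) k z :
  tensor_coord C k (tensor_mapr F g z) = g (tensor_coord B k z).
Proof.
elim/tensor_ind: z => [|u w eu ew|x n];
  [by rewrite !linear0 | by rewrite !linearD eu ew |].
by rewrite tensor_mapr_pure !tensor_coord_pure linearZ.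
Qed.

(** Free modules are flat: the coordinates of a tensor killed by [F (x) g] all
    lie in [ker g]. *)
Lemma free_tensor_exact (B C : lmodType A) (g : {linear B -> C}) z :
  tensor_mapr F g z = 0 -> exists y, z = tensor_mapr F (ker_incl g) y.
Proof.
move=> gz0; have [s ->] := tensor_coord_sum z.
have gc k : g (tensor_coord B k z) = 0.
  by rewrite -tensor_coord_mapr gz0 linear0.
exists (\sum_(k <- s) pure (<< k >> : F)
          (Kermod (introT eqP (gc k)) : kermod g)).
by rewrite linear_sum; apply: eq_bigr => k _; rewrite tensor_mapr_pure.
Qed.
End FreeFlat.
End TensorProducts.
(** * Almost flat modules are almost exact *)

Section StandardResolution.
Variables (A : comNzRingType) (M : lmodType A).

Lemma cover_map_surj (V : lmodType A) (y : V) :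
  exists z, y = cover_map V z.
Proof. by exists << y >>; rewrite /cover_map free_liftU. Qed.

(** Exactness of the resolution, at [F_0] with its augmentation for [n = 0]. *)
Lemma resolution_diff_im n z : cover_map (syzygy M n) z = 0 ->
  exists y, z = resolution_diff M n y.
Proof.
move=> z0.
have [y yE] := cover_map_surj (Kermod (introT eqP z0) : syzygy M n.+1).
by exists y; rewrite /resolution_diff /comp -[RHS]/(ker_val _) -yE.
Qed.

Lemma cover_map_resolution_diff n y :
  cover_map (syzygy M n) (resolution_diff M n y) = 0.
Proof. exact: ker_inclP. Qed.

Lemma resolution_diff_diff n y :
  resolution_diff M n (resolution_diff M n.+1 y) = 0.
Proof.
rewrite -[LHS]/(ker_incl _ (cover_map _ (resolution_diff M n.+1 y))).
by rewrite cover_map_resolution_diff linear0.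
Qed.
End StandardResolution.

Section AlmostExactness.
Variables (K : realType) (A : comNzRingType) (v : A -> \bar K).

(** Lift [w] to [w0] in [F_0 (x) B].  Then [g w0 = d1 c] with [c] in [F_1 (x) C],
    and [c] becomes a cycle in [F_1 (x) coker g].  Its class in
    [Tor_1 (M, coker g)] is killed by a small [b], so [b c - d2 u = g y] for some
    [u] in [F_2 (x) C] and [y] in [F_1 (x) B].  Now [b w0 - d1 y] is killed by
    [g], so it comes from [F_0 (x) ker g] as [F_0] is flat, and it still lifts
    [b w]. *)
Lemma almost_flat_exact (M B C : lmodType A) (g : {linear B -> C})
    (w : tensor B M) (e : K) :
  almost_flat v M -> tensor_map M g w = 0 -> 0 < e ->
  exists b, (v b < e%:E)%E /\ exists y, b *: w = tensor_map M (ker_incl g) y.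
Proof.
move=> flatM gw0 e0.
set d1 := resolution_diff M 0; set d2 := resolution_diff M 1.
have p_surj := @cover_map_surj A M.
have [w0 w0E] := tensor_map_surj p_surj (tensor_swap B M w).
have [c cE] : exists c, tensor_mapr _ g w0 = tensor_map C d1 c.
  apply: (tensor_map_right_exact p_surj (@resolution_diff_im A M 0)).
  rewrite tensor_map_mapr -w0E tensor_mapr_swap tensor_swapK gw0.
  by rewrite linear0.
pose q := coker_pi g; have q_surj := @coker_pi_surj _ _ _ g.
have qg (P : lmodType A) (z : tensor P B) :
    tensor_mapr P q (tensor_mapr P g z) = 0.
  elim/tensor_ind: z => [|u u' eu eu'|x n]; first by rewrite !linear0.
    by rewrite !linearD eu eu' addr0.
  rewrite !tensor_mapr_pure (_ : q _ = 0) ?pure0r //.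
  by apply/coker_pi0P; exists n.
have qc0 : tensor_map (cokermod g) d1 (tensor_mapr _ q c) = 0.
  by rewrite tensor_map_mapr -cE qg.
have [b []] := flatM 1%N (cokermod g) isT
  (homology_class _ _ (Kermod (introT eqP qc0))) e e0.
rewrite -linearZ => /homology_class0P[u' uE0] vb; exists b; split=> //.
have uE : b *: tensor_mapr _ q c = tensor_map (cokermod g) d2 u' by exact: uE0.
have [u u'E] := tensor_mapr_surj q_surj u'.
have [y yE] : exists y, b *: c - tensor_map C d2 u = tensor_mapr _ g y.
  apply: (tensor_mapr_right_exact q_surj) => [x /coker_pi0P //|].
  by rewrite linearB linearZZ uE u'E tensor_map_mapr subrr.
have d12 (z : tensor (resolution M 2) C) :
    tensor_map C d1 (tensor_map C d2 z) = 0.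
  rewrite tensor_map_comp; apply: tensor_map0; exact: resolution_diff_diff.
have [z zE] : exists z,
    b *: w0 - tensor_map B d1 y = tensor_mapr _ (ker_incl g) z.
  apply: free_tensor_exact.
  rewrite linearB linearZZ cE -tensor_map_mapr -yE linearB d12 subr0.
  by rewrite linearZ subrr.
exists (tensor_swap _ _ (tensor_map _ (cover_map M) z)).
rewrite tensor_map_swap tensor_swapK -tensor_map_mapr -zE linearB linearZZ.
rewrite -w0E tensor_map_comp (tensor_map0 (f := _ \o _)) ?subr0.
  by rewrite linearZ tensor_swapK.
exact: cover_map_resolution_diff.
Qed.

Lemma almost_flat_inj (M B C : lmodType A) (g : {linear B -> C})
    (w : tensor B M) (e : K) :
  almost_flat v M -> (forall y, g y = 0 -> y = 0) ->
  tensor_map M g w = 0 -> 0 < e -> exists b, (v b < e%:E)%E /\ b *: w = 0.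
Proof.
move=> flatM g0 gw0 /(almost_flat_exact flatM gw0)[b [vb [y yE]]].
exists b; split=> //; rewrite yE; apply: tensor_map0 => u.
by apply: g0; exact: ker_inclP.
Qed.

(** * Almost zero modules *)

Section ValueMap.
Hypothesis v_val : value_map v.

Lemma small_mul (e : K) b b' : (v b < (e / 2)%:E)%E -> (v b' < (e / 2)%:E)%E ->
  (v (b * b') < e%:E)%E.
Proof.
case: v_val => _ _ vM _ vb vb'.
by rewrite vM [e]splitr EFinD lteD.
Qed.

(** Every tensor is a finite sum of pure tensors, and a product of small
    annihilators of the summands is a small annihilator of the sum. *)
Lemma almost_zero_pure (N M : lmodType A) :
  (forall (n : N) (m : M) (e : K), 0 < e ->
     exists b : A, b *: pure n m = 0 /\ (v b < e%:E)%E) ->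
  almost_zero v (tensor N M).
Proof.
move=> pure0; elim/tensor_ind => [|u w u0 w0|n m] e e0; last exact: pure0.
  by have [b [_ vb]] := pure0 0 0 e e0; exists b; rewrite scaler0.
have e2 : 0 < e / 2 by rewrite divr_gt0.
have [b [bu vb]] := u0 _ e2; have [b' [bw vb']] := w0 _ e2.
exists (b * b'); split; last exact: small_mul.
by rewrite scalerDr {1}[b * b']mulrC -!scalerA bu bw !scaler0 addr0.
Qed.

Lemma almost_zero_tensor (N M : lmodType A) :
  almost_zero v N -> almost_zero v (tensor N M).
Proof.
move=> N0; apply: almost_zero_pure => n m e e0.
by have [b [bn vb]] := N0 n e e0; exists b; rewrite -pureZl bn pure0l.
Qed.

Lemma almost_iso_zero (L N : lmodType A) (f : {linear L -> N}) :
  almost_iso v f -> almost_zero v L <-> almost_zero v N.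
Proof.
case=> kf cf; split=> [L0 n|N0 l] e e0; have e2 : 0 < e / 2 by rewrite divr_gt0.
  have [b []] := cf (coker_pi f n) _ e2.
  rewrite -linearZ => /coker_pi0P[l lE] vb.
  have [b' [b'l vb']] := L0 l _ e2.
  exists (b' * b); split; last exact: small_mul.
  by rewrite -scalerA lE -linearZ b'l linear0.
have [b [bf vb]] := N0 (f l) _ e2.
have bl : f (b *: l) = 0 by rewrite linearZ.
have [b' [/(congr1 (ker_incl f)) b'l vb']] := kf (Kermod (introT eqP bl)) _ e2.
exists (b' * b); split; last exact: small_mul.
rewrite -scalerA -[b *: l]/(ker_incl f (Kermod (introT eqP bl))).
by rewrite -linearZ b'l linear0.
Qed.

Lemma almost_equiv_zero (N N' : lmodType A) :
  almost_equiv v N N' -> almost_zero v N' -> almost_zero v N.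
Proof.
move=> [L [f [g [isof isog]]]] N'0.
by apply/(almost_iso_zero isof)/(almost_iso_zero isog).
Qed.

(** Even the identity needs scalars of small value, since zero itself must have
    small annihilators for any module to be almost zero. *)
Lemma almost_iso_id (N : lmodType A) :
  (forall e : K, 0 < e -> exists b, (v b < e%:E)%E) ->
  almost_iso v (idfun : {linear N -> N}).
Proof.
move=> small; split=> y e /small[b vb]; exists b; split=> //.
  apply: ker_incl_inj; rewrite linearZ linear0.
  by have := ker_inclP y => /= ->; rewrite scaler0.
have [z ->] := coker_pi_surj y.
by rewrite -linearZ; apply/coker_pi0P; exists (b *: z).
Qed.

(** * Homology after tensoring with an almost flat module *)

Section HomologyBaseChange.
(** The row [U' -> V' -> W'] stands for [U (x) M -> V (x) M -> W (x) M].  Keeping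
    it abstract allows a row that is only isomorphic to these tensor products,
    such as a piece of the Cech complex of [M]. *)
Variables (M U V W U' V' W' : lmodType A).
Variables (f : {linear U -> V}) (g : {linear V -> W}).
Variables (f' : {linear U' -> V'}) (g' : {linear V' -> W'}).
Variables (phiU : {linear tensor U M -> U'}) (phiV : {linear tensor V M -> V'}).
Variable phiW : {linear tensor W M -> W'}.
Hypothesis phi_f : forall z, phiV (tensor_map M f z) = f' (phiU z).
Hypothesis phi_g : forall z, phiW (tensor_map M g z) = g' (phiV z).
Hypothesis phiU_surj : forall y, exists z, y = phiU z.
Hypothesis phiV_surj : forall y, exists z, y = phiV z.
Hypothesis phiV_inj : forall z, phiV z = 0 -> z = 0.
Hypothesis phiW_inj : forall z, phiW z = 0 -> z = 0.

Let incl_tensor : {linear tensor (kermod g) M -> V'} :=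
  (phiV : {linear _ -> _}) \o tensor_map M (ker_incl g).

Lemma cycle_tensor_subproof z : g' (incl_tensor z) = 0.
Proof.
rewrite -[incl_tensor z]/(phiV (tensor_map M (ker_incl g) z)) -phi_g.
rewrite tensor_map_comp tensor_map0 ?linear0 //; exact: ker_inclP.
Qed.

Definition cycle_tensor : {linear tensor (kermod g) M -> kermod g'} :=
  ker_lift cycle_tensor_subproof.

Lemma cycle_tensor_val z :
  ker_incl g' (cycle_tensor z) = phiV (tensor_map M (ker_incl g) z).
Proof. by []. Qed.

Section FixedVector.
Variable m : M.

Definition class_tensor_fun (z : kermod g) : homology f' g' :=
  homology_class f' g' (cycle_tensor (pure z m)).

Lemma class_tensor_linear : linear class_tensor_fun.
Proof. by move=> a z z'; rewrite /class_tensor_fun pureDl pureZl !linearP. Qed.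

HB.instance Definition _ := GRing.isLinear.Build A (kermod g) (homology f' g')
  *:%R class_tensor_fun class_tensor_linear.

Lemma class_tensor_bound z :
  z \in @bound_pred A U V W f g -> class_tensor_fun z = 0.
Proof.
move=> /asboolP[u zE]; apply/homology_class0P; exists (phiU (pure u m)).
by rewrite cycle_tensor_val tensor_map_pure -phi_f tensor_map_pure -zE.
Qed.

Definition homology_tensor_at : {linear homology f g -> homology f' g'} :=
  quotmod_lift class_tensor_bound.

Lemma homology_tensor_at_class z : homology_tensor_at (homology_class f g z) =
  homology_class f' g' (cycle_tensor (pure z m)).
Proof. exact: quotmod_lift_pi. Qed.
End FixedVector.

Lemma homology_tensor_linearr (h : homology f g) :
  linear (fun m => homology_tensor_at m h).
Proof.
have [z ->] := homology_class_surj h => a m m'.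
by rewrite !homology_tensor_at_class pureDr pureZr !linearP.
Qed.

(** The canonical map [class z (x) m |-> class (z (x) m)]. *)
Definition homology_tensor :
    {linear tensor (homology f g) M -> homology f' g'} :=
  tensor_lift (fun m => linearP (homology_tensor_at m)) homology_tensor_linearr.

Lemma homology_tensor_class z :
  homology_tensor (tensor_map M (homology_class f g) z) =
  homology_class f' g' (cycle_tensor z).
Proof.
elim/tensor_ind: z => [|u w eu ew|z m];
  [by rewrite !linear0 | by rewrite !linearD eu ew |].
rewrite tensor_map_pure [LHS]tensor_lift_pure; exact: homology_tensor_at_class.
Qed.

(** For the kernel, let [u] in [ker g (x) M] become a boundary, the image of
    [w] in [U (x) M].  Then [w] is killed by the composite [U -> V -> W], so a
    multiple [b w] comes from its kernel; the elements of that kernel map to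
    boundaries in [ker g].  So [b u] agrees with a boundary after the inclusion
    into [V (x) M], hence, up to another small factor, before it.  For the
    cokernel, a cycle in [V (x) M] has a small multiple coming from
    [ker g (x) M]. *)
Lemma homology_tensor_almost_iso :
  almost_flat v M -> almost_iso v homology_tensor.
Proof.
move=> flatM; split=> y e e0; have e2 : 0 < e / 2 by rewrite divr_gt0.
  have [u uE] :=
    tensor_map_surj (@homology_class_surj _ _ _ _ f g) (ker_incl _ y).
  have := ker_inclP y; rewrite uE homology_tensor_class.
  move=> /homology_class0P[w']; have [w ->] := phiU_surj w'.
  rewrite cycle_tensor_val -phi_f => /eqP.
  rewrite -subr_eq0 -linearB => /eqP/phiV_inj/eqP; rewrite subr_eq0 => /eqP uw.
  pose gf : {linear U -> W} := (g : {linear _ -> _}) \o f.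
  have gfw : tensor_map M gf w = 0.
    rewrite -tensor_map_comp -uw tensor_map_comp; apply: tensor_map0.
    exact: ker_inclP.
  have [b [vb [w1 w1E]]] := almost_flat_exact flatM gfw e2.
  pose fr : {linear kermod gf -> V} := (f : {linear _ -> _}) \o ker_incl gf.
  have frg x : g (fr x) = 0 by exact: (ker_inclP x).
  pose r := ker_lift frg.
  pose u' := b *: u - tensor_map M r w1.
  have u'0 : tensor_map M (ker_incl g) u' = 0.
    rewrite linearB linearZZ uw -linearZ w1E !tensor_map_comp.
    by apply/eqP; rewrite subr_eq0; apply/eqP/eq_tensor_map.
  have [b' [vb' b'u]] := almost_flat_inj flatM (@ker_incl0 _ _ _ g) u'0 e2.
  exists (b' * b); split; last exact: small_mul.
  apply: ker_incl_inj; rewrite linearZ uE linear0 -linearZ.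
  move/eqP: b'u; rewrite scalerBr subr_eq0 scalerA => /eqP ->.
  rewrite linearZZ tensor_map_comp tensor_map0 ?scaler0 // => x.
  by apply/homology_class0P; exists (ker_incl gf x).
have [h ->] := coker_pi_surj y; have [z ->] := homology_class_surj h.
have [w wE] := phiV_surj (ker_incl g' z).
have gw0 : tensor_map M g w = 0.
  by apply: phiW_inj; rewrite phi_g -wE; exact: ker_inclP.
have [b [vb [u uE]]] := almost_flat_exact flatM gw0 e0.
exists b; split=> //; rewrite -linearZ; apply/coker_pi0P.
exists (tensor_map M (homology_class f g) u).
rewrite homology_tensor_class -linearZ; congr (homology_class f' g' _).
by apply: ker_incl_inj; rewrite cycle_tensor_val linearZ wE -uE linearZ.
Qed.
End HomologyBaseChange.
End ValueMap.
End AlmostExactness.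
(** * Base change of the Cech complex *)

Local Notation frac := Defs.frac.

Section LocalizationTensor.
Variables (A : comNzRingType) (M : lmodType A).

Lemma frac_ind (V : lmodType A) (a : A) (y : loc V a) :
  exists t n, y = frac a t n.
Proof. by exists (repr y).1, (repr y).2; rewrite frac_repr. Qed.

Lemma frac_expand (V : lmodType A) (a : A) (t : V) n k :
  frac a t n = a ^+ k *: frac a t (n + k).
Proof.
by rewrite fracZ; apply/fracP; exists 0%N; rewrite !add0n scalerA exprD.
Qed.

Section Fixed.
Variable a : A.

Definition loc_act (y : loc A^o a) (m : M) : loc M a :=
  frac a ((repr y).1 *: m) (repr y).2.

Lemma loc_act_frac (t : A^o) n m : loc_act (frac a t n) m = frac a (t *: m) n.
Proof.
have [k e] := frac_reprP a t n; apply/fracP; exists k.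
by rewrite !scalerA; congr (_ *: m).
Qed.

Lemma loc_act_linearl m : linear (loc_act^~ m).
Proof.
move=> b y z; have [t [n ->]] := frac_ind y; have [s [k ->]] := frac_ind z.
rewrite fracZ fracD !loc_act_frac fracZ fracD scalerDl !scalerA.
by congr (frac _ _ _); rewrite /GRing.scale /= mulrA.
Qed.

Lemma loc_act_linearr y : linear (loc_act y).
Proof.
move=> b m m'; have [t [n ->]] := frac_ind y.
rewrite !loc_act_frac fracZ fracD; apply/fracP; exists 0%N.
rewrite !add0n !scalerDr !scalerA -!exprD; congr (_ *: _ + _).
exact: mulrAC.
Qed.

Definition loc_tensor : {linear tensor (loc A^o a) M -> loc M a} :=
  tensor_lift loc_act_linearl loc_act_linearr.

Lemma loc_tensor_frac (t : A^o) n m :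
  loc_tensor (pure (frac a t n) m) = frac a (t *: m) n.
Proof. by rewrite [LHS]tensor_lift_pure loc_act_frac. Qed.

Lemma loc_tensor_surj y : exists z, y = loc_tensor z.
Proof.
have [m [n ->]] := frac_ind y.
by exists (pure (frac a (1 : A^o) n) m); rewrite loc_tensor_frac scale1r.
Qed.

(** A common denominator can be found for finitely many fractions, so every
    tensor is pure. *)
Lemma loc_tensor_normal z :
  exists n m, z = pure (frac a (1 : A^o) n : loc A^o a) (m : M).
Proof.
elim/tensor_ind: z => [|u w [n [m ->]] [n' [m' ->]]|y m].
- by exists 0%N, 0; rewrite pure0r.
- exists (n + n')%N, (a ^+ n' *: m + a ^+ n *: m').
  rewrite pureDr !pureZr -!pureZl -frac_expand.
  by rewrite [(n + n')%N]addnC -frac_expand.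
have [t [n ->]] := frac_ind y; exists n, (t *: m).
by rewrite pureZr -pureZl fracZ /GRing.scale /= mulr1.
Qed.

(** If [m / a^n = 0], then [a^k m = 0] for some [k], and
    [1 / a^n (x) m = 1 / a^(n + k) (x) a^k m]. *)
Lemma loc_tensor_inj z : loc_tensor z = 0 -> z = 0.
Proof.
have [n [m ->]] := loc_tensor_normal z.
rewrite loc_tensor_frac scale1r => /fracP[k].
rewrite addn0 scaler0 => akm.
by rewrite (frac_expand _ _ _ k) pureZl -pureZr akm pure0r.
Qed.
End Fixed.

Lemma loc_tensor_locmap (a b c : A) (cab : c = a * b) (y : loc A^o a) (m : M) :
  loc_tensor c (pure (locmap A^o cab y) m) =
  locmap M cab (loc_tensor a (pure y m)).
Proof.
have [t [n ->]] := frac_ind y.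
by rewrite [locmap _ _ _]locmap_frac !loc_tensor_frac [RHS]locmap_frac scalerA.
Qed.
End LocalizationTensor.

Section ProductTensor.
Variables (A : comNzRingType) (I : finType) (V : I -> lmodType A).

Section Coordinates.
Variable i : I.

Definition prodmod_proj_fun (f : prodmod V) : V i := f i.

Lemma prodmod_proj_linear : linear prodmod_proj_fun.
Proof. by move=> a f g; rewrite /prodmod_proj_fun prodmodPE. Qed.

HB.instance Definition _ := GRing.isLinear.Build A (prodmod V) (V i) *:%R
  prodmod_proj_fun prodmod_proj_linear.

Definition prodmod_proj : {linear prodmod V -> V i} := prodmod_proj_fun.

Definition prodmod_inj_fun (y : V i) : prodmod V :=
  finfun (dfwith (fun j => 0 : V j) y).

Lemma prodmod_inj_linear : linear prodmod_inj_fun.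
Proof.
move=> a y z; apply/ffunP => j; rewrite prodmodPE !ffunE.
have [ij|ij] := eqVneq i j; last by rewrite !dfwith_out // scaler0 addr0.
by case: j / ij; rewrite !dfwith_in.
Qed.

HB.instance Definition _ := GRing.isLinear.Build A (V i) (prodmod V) *:%R
  prodmod_inj_fun prodmod_inj_linear.

Definition prodmod_inj : {linear V i -> prodmod V} := prodmod_inj_fun.
End Coordinates.

Lemma prodmod_injK i y : prodmod_proj i (prodmod_inj i y) = y.
Proof. by rewrite /= /prodmod_proj_fun ffunE dfwith_in. Qed.

Lemma prodmod_inj_out i j y : i != j -> prodmod_proj j (prodmod_inj i y) = 0.
Proof. by move=> ij; rewrite /= /prodmod_proj_fun ffunE dfwith_out. Qed.

Lemma prodmod_sum_inj f : f = \sum_i prodmod_inj i (prodmod_proj i f).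
Proof.
apply/ffunP => j; rewrite -[RHS]/(prodmod_proj j _) linear_sum.
rewrite (bigD1 j) //= big1 => [|i ij]; last exact: prodmod_inj_out.
by rewrite [X in X + _]prodmod_injK addr0.
Qed.

Variables (M : lmodType A) (W : I -> lmodType A).
Variable phi : forall i, {linear tensor (V i) M -> W i}.

(** Tensoring commutes with finite products; a comparison map is assembled from
    comparison maps of the factors. *)
Definition prod_tensor_fun (z : tensor (prodmod V) M) : prodmod W :=
  finfun (fun i => phi i (tensor_map M (prodmod_proj i) z)).

Lemma prod_tensor_linear : linear prod_tensor_fun.
Proof.
by move=> a y z; apply/ffunP => i; rewrite prodmodPE !ffunE !linearP.
Qed.

HB.instance Definition _ := GRing.isLinear.Build A
  (tensor (prodmod V) M) (prodmod W) *:%R prod_tensor_fun prod_tensor_linear.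

Definition prod_tensor : {linear tensor (prodmod V) M -> prodmod W} :=
  prod_tensor_fun.

Lemma prod_tensorE z i :
  prod_tensor z i = phi i (tensor_map M (prodmod_proj i) z).
Proof. exact: ffunE. Qed.

Lemma tensor_sum_inj z : z =
  \sum_i tensor_map M (prodmod_inj i) (tensor_map M (prodmod_proj i) z).
Proof.
elim/tensor_ind: z => [|u w eu ew|f m].
- by rewrite big1 // => i _; rewrite !linear0.
- rewrite {1}eu {1}ew -big_split; apply: eq_bigr => i _.
  by rewrite !linearD.
rewrite {1}[f]prodmod_sum_inj pure_suml; apply: eq_bigr => i _.
by rewrite !tensor_map_pure.
Qed.

Lemma prod_tensor_inj : (forall i z, phi i z = 0 -> z = 0) ->
  forall z, prod_tensor z = 0 -> z = 0.
Proof.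
move=> phi0 z z0; rewrite [z]tensor_sum_inj big1 // => i _.
rewrite (phi0 i (tensor_map _ _ _)) ?linear0 // -prod_tensorE z0.
by rewrite ffunE.
Qed.

Lemma prod_tensor_surj : (forall i y, exists z, y = phi i z) ->
  forall y, exists z, y = prod_tensor z.
Proof.
move=> phi_surj y; pose u i := sval (cid (phi_surj i (y i))).
have uE i : phi i (u i) = y i by rewrite /u; case: cid.
exists (\sum_i tensor_map M (prodmod_inj i) (u i)); apply/ffunP => j.
rewrite prod_tensorE !linear_sum (bigD1 j) // big1 => [|i ij].
  rewrite [RHS]addr0 tensor_map_comp -uE; congr (phi j _).
  elim/tensor_ind: (u j) => [|z w ez ew|t m];
    [by rewrite linear0 | by rewrite linearD -ez -ew |].
  rewrite tensor_map_pure; congr (pure _ m); exact/esym/prodmod_injK.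
rewrite tensor_map_comp tensor_map0 ?linear0 // => t.
exact: prodmod_inj_out.
Qed.
End ProductTensor.

Section CechTensor.
Variables (A : comNzRingType) (d : nat) (x : 'I_d -> A) (M : lmodType A).

Definition cech_tensor (n : int) :
    {linear tensor (cech x A^o n) M -> cech x M n} :=
  prod_tensor (fun I : cech_index d n => loc_tensor M (subprod x (val I))).

Lemma cech_tensor_surj n y : exists z, y = cech_tensor n z.
Proof. by apply: prod_tensor_surj => I; exact: loc_tensor_surj. Qed.

Lemma cech_tensor_inj n z : cech_tensor n z = 0 -> z = 0.
Proof. by apply: prod_tensor_inj => I; exact: loc_tensor_inj. Qed.

Lemma cech_tensor_diff p q (epq : q = p + 1) z :
  cech_tensor q (tensor_map M (cech_diff x A^o epq) z) =
  cech_diff x M epq (cech_tensor p z).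
Proof.
elim/tensor_ind: z => [|u w eu ew|f m];
  [by rewrite !linear0 | by rewrite !linearD eu ew |].
apply/ffunP => J; rewrite tensor_map_pure [LHS]prod_tensorE [RHS]ffunE.
rewrite tensor_map_pure [X in pure X _]ffunE pure_suml linear_sum.
apply: eq_bigr => j _.
rewrite pureZl linearZZ loc_tensor_locmap; congr (_ *: locmap _ _ _).
by rewrite [RHS]prod_tensorE tensor_map_pure.
Qed.

Lemma cech_cohomology_tensor (K : realType) (v : A -> \bar K) (n : int) :
  value_map v -> almost_flat v M ->
  exists f : {linear tensor (cech_cohomology x A^o n) M ->
                     cech_cohomology x M n},
    almost_iso v f.
Proof.
move=> v_val flatM; pose phi i := cech_tensor i.
have phiD p q epq z := @cech_tensor_diff p q epq z.
exists (homology_tensor (phiD _ _ _) (phiD _ _ _)).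
apply: (homology_tensor_almost_iso v_val) => //;
  by [exact: cech_tensor_surj | exact: cech_tensor_inj].
Qed.
End CechTensor.

(** * The residue module *)

Section Residue.
Variables (K : realType) (R : comNzRingType) (T : comAlgType R).
Variables (v : T -> \bar K) (m : {pred R}) (M : lmodType T).

Let res (V : lmodType T) := residue_module m V.

Definition residue_pi (V : lmodType T) : {linear V -> res V} :=
  quotmod_pi (Defs.span (fun y : V => exists2 r, r \in m &
                                        exists z, y = r%:A *: z)).

Lemma residue_pi0 (V : lmodType T) (r : R) (z : V) :
  r \in m -> residue_pi V (r%:A *: z) = 0.
Proof.
move=> rm; apply/quotmod_pi0P/asboolP; exists [:: (1, r%:A *: z)].
rewrite big_seq1 scale1r; split=> // p; rewrite inE => /eqP -> /=.
by exists r => //; exists z.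
Qed.

Let one : res T^o := residue_pi T^o (1 : T^o).

(** For [p = r z] with [r] in the ideal, [p (x) 1 = z (x) r 1 = 0]. *)
Lemma pure_one_residue0 (p : M) : residue_pi M p = 0 -> pure p one = 0.
Proof.
move=> /quotmod_pi0P/asboolP[s [sP ->]]; rewrite pure_suml big_seq big1 //.
case=> a y /sP[r rm [z /= ->]].
have one0 : r%:A *: one = 0 by rewrite /one -linearZZ residue_pi0.
by rewrite pureZl pureZl -pureZr one0 pure0r scaler0.
Qed.

Hypothesis v_val : value_map v.

(** Every pure tensor [p (x) t 1] equals [t p (x) 1], and a small multiple of
    [t p] lies in [m M]. *)
Lemma almost_zero_tensor_residue :
  almost_zero v (res M) -> almost_zero v (tensor M (res T^o)).
Proof.
move=> resM; apply: (almost_zero_pure v_val) => p y e e0.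
have [t ->] : exists t : T, y = t *: one.
  have [t ->] := quotmod_pi_surj y; exists t.
  by rewrite /one -linearZZ [t *: (1 : T^o)]mulr1.
have [b [bp vb]] := resM (residue_pi M (t *: p)) e e0.
exists b; split=> //; rewrite pureZr -!pureZl.
by apply: pure_one_residue0; rewrite linearZ.
Qed.
End Residue.

Theorem theorem4p3 (K : realType) (R : comNzRingType) (m : {pred R}) (d : nat)
    (x : 'I_d -> R) (T : comAlgType R) (v : T -> \bar K) (M : lmodType T) :
  noetherian R -> local_ring m -> krull_dim R d ->
  system_of_parameters m x ->
  value_map v ->
  almost_CM v m x T^o ->
  almost_faithfully_flat v M ->
  (forall i : int,
     almost_equiv v (local_cohomology x (d%:Z - i) M)
       (tensor (local_cohomology x (d%:Z - i) T^o) M)) /\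
  almost_CM v m x M.
Proof.
move=> _ _ _ _ v_val [cohT resT] [flatM faithM].
have small (e : K) : 0 < e -> exists b, (v b < e%:E)%E.
  (* Almost vanishing in a single degree already yields scalars of small
     value. *)
  have d1 : d%:Z + 1 != d%:Z by rewrite -subr_eq0 addrAC subrr.
  by move=> /(cohT _ d1 0)[b [_ vb]]; exists b.
have equiv (n : int) : almost_equiv v (local_cohomology x n M)
    (tensor (local_cohomology x n T^o) M).
  have [f isof] := cech_cohomology_tensor (fun i => (x i)%:A : T) n v_val flatM.
  exists (tensor (local_cohomology x n T^o) M), f, idfun.
  by split; [exact: isof | exact: almost_iso_id].
split=> [i|]; first exact: equiv.
split=> [n nd|resM].
  apply: (almost_equiv_zero v_val (equiv n)).
  by apply: (almost_zero_tensor v_val); apply: cohT.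
by apply/resT/faithM/almost_zero_tensor_residue.
Qed.
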